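(* $BR(C_8,C_8)=8$.
   Context: $C_m$ denotes the cycle on $m$ vertices and $K_{b,b}$ the complete bipartite graph with both parts of size $b$. For bipartite graphs $G_1,G_2$, $BR(G_1,G_2)$ is the smallest positive integer $b$ such that for every 2-edge-coloring of $K_{b,b}$ with colors 1 and 2, there is a subgraph isomorphic to $G_1$ all of whose edges have color 1, or a subgraph isomorphic to $G_2$ all of whose edges have color 2. *)

(* Defs.v *)
From mathcomp Require Import all_boot.

Set Implicit Arguments.
Unset Strict Implicit.
Unset Printing Implicit Defensive.

Record sgraph := SGraph {
  vertex :> finType;
  adj : rel vertex;
  adj_sym : symmetric adj;
  adj_irrefl : irreflexive adj }.

Definition edges (G : sgraph) : {set {set G}} :=
  [set e | [exists u : G, exists v : G, adj u v && (e == [set u; v])]].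

(* The conjunct i != j only matters for m = 1, where ordS is the identity. *)
Definition cycle_adj (m : nat) : rel 'I_m :=
  fun i j => (i != j) && ((ordS i == j) || (ordS j == i)).

Lemma cycle_adj_sym m : symmetric (@cycle_adj m).
Proof. by move=> i j; rewrite /cycle_adj eq_sym orbC. Qed.

Lemma cycle_adj_irrefl m : irreflexive (@cycle_adj m).
Proof. by move=> i; rewrite /cycle_adj eqxx. Qed.

Definition cycle_graph (m : nat) : sgraph :=
  SGraph (@cycle_adj_sym m) (@cycle_adj_irrefl m).

Definition biclique_adj (a b : nat) : rel ('I_a + 'I_b)%type :=
  fun x y => match x, y with
             | inl _, inr _ | inr _, inl _ => true
             | _, _ => false
             end.

Lemma biclique_adj_sym a b : symmetric (@biclique_adj a b).
Proof. by move=> [x|x] [y|y]. Qed.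

Lemma biclique_adj_irrefl a b : irreflexive (@biclique_adj a b).
Proof. by case. Qed.

Definition biclique (a b : nat) : sgraph :=
  SGraph (@biclique_adj_sym a b) (@biclique_adj_irrefl a b).

Definition is_subgraph (G : sgraph) (S : {set G}) (F : {set {set G}}) : Prop :=
  F \subset edges G /\ forall e, e \in F -> e \subset S.

Definition isomorphic_to (H G : sgraph) (S : {set G}) (F : {set {set G}}) : Prop :=
  exists f : H -> G,
    [/\ injective f,
        f @: [set: H] = S
      & forall u v : H, adj u v = ([set f u; f v] \in F)].

(* Colour 1 is true and colour 2 is false; the values of a colouring on sets
   that are not edges are never used. *)
Definition edge_coloring (G : sgraph) := {set G} -> bool.

Definition mono_copy (H G : sgraph) (c : edge_coloring G) (k : bool) : Prop :=
  exists (S : {set G}) (F : {set {set G}}),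
    [/\ is_subgraph S F,
        isomorphic_to H S F
      & forall e, e \in F -> c e = k].

Definition bip_arrows (b : nat) (G1 G2 : sgraph) : Prop :=
  forall c : edge_coloring (biclique b b),
    mono_copy G1 c true \/ mono_copy G2 c false.

Definition is_BR (G1 G2 : sgraph) (b : nat) : Prop :=
  [/\ 0 < b,
      bip_arrows b G1 G2
    & forall b' : nat, 0 < b' -> bip_arrows b' G1 G2 -> b <= b'].

(* Main.v *)
Require Import Defs.
From mathcomp Require Import all_boot.

(** Upper bound: already K_{8,7} suffices. Each of its 8 rows of 7 entries has a
    majority colour, so after exchanging the colours four rows are mostly red;
    put these first and sort the columns lexicographically. Four rows with at
    least four red entries each among 7 columns almost always contain a red C_8,
    so an exhaustive row-by-row search dies out after about a thousand nodes.

    Lower bound: colour K_{7,7} so that red consists of two copies of K_{3,4}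
    sharing one column, and blue of two copies of K_{4,3} sharing one row (plus
    the pendant edge of the shared column). A cycle lies inside a block, and each
    block has a side with only three vertices. *)

Set Implicit Arguments.
Unset Strict Implicit.
Unset Printing Implicit Defensive.

(** * Monochromatic copies as injective homomorphisms *)

Lemma set2_eq (T : finType) (a b x y : T) :
  [set a; b] = [set x; y] -> x != y -> a = x /\ b = y \/ a = y /\ b = x.
Proof.
move=> E nxy; have := set21 x y; have := set22 x y.
by rewrite -E !inE => /orP[]/eqP Ey /orP[]/eqP Ex; move: nxy;
  rewrite Ex Ey ?eqxx //; auto.
Qed.

(** Copies need not be induced, so a copy of [H] amounts to an injective map that preserves
    adjacency and sends every edge to colour [k]. *)
Lemma mono_copyP (H G : sgraph) (c : edge_coloring G) (k : bool) :
  mono_copy H c k <->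
  exists f : H -> G, injective f /\
    forall u v : H, adj u v -> adj (f u) (f v) /\ c [set f u; f v] = k.
Proof.
have neq_f (f : H -> G) u v : injective f -> adj u v -> f u != f v.
  by move=> inj_f uv; apply: contraTneq uv => /inj_f->; rewrite adj_irrefl.
split.
  move=> [S [F [[FE _] [f [inj_f _ adjF]] cF]]]; exists f; split=> // u v uv.
  have uvF : [set f u; f v] \in F by rewrite -adjF.
  split; last exact: cF.
  move/subsetP/(_ _ uvF): FE; rewrite inE => /existsP[x /existsP[y]].
  case/andP=> xy /eqP/esym E.
  by case: (set2_eq E (neq_f _ _ _ inj_f uv)) => -[<- <-]; rewrite // adj_sym.
move=> [f [inj_f hf]].
(* [F] contains the images of edges of [H] only, since adjacency in the copy must match [H]
   exactly. *)
exists (f @: [set: H]), [set [set f p.1; f p.2] | p in [pred p : H * H | adj p.1 p.2]].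
split.
- split.
    apply/subsetP=> e /imsetP[[u v] /= uv ->]; rewrite inE.
    by apply/existsP; exists (f u); apply/existsP; exists (f v);
      rewrite eqxx (hf _ _ uv).1.
  move=> e /imsetP[[u v] /= _ ->]; apply/subsetP=> x.
  by rewrite !inE => /orP[]/eqP->; rewrite imset_f.
- exists f; split=> // u v; apply/idP/imsetP => [uv|[[x y] /= xy E]].
    by exists (u, v).
  rewrite inE /= in xy.
  by case: (set2_eq E (neq_f _ _ _ inj_f xy)) => -[/inj_f-> /inj_f->]; rewrite // adj_sym.
- by move=> e /imsetP[[u v] /= uv ->]; rewrite (hf _ _ uv).2.
Qed.

(** * Eight-cycles in Boolean matrices *)

(** The cycle runs [i0 j0 i1 j1 i2 j2 i3 j3] through rows and columns. Natural indices let the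
    search be evaluated and boards be embedded without casts. *)
Definition has_c8 (m n : nat) (M : nat -> nat -> bool) (k : bool) : Prop :=
  exists i0 i1 i2 i3 j0 j1 j2 j3 : nat,
    [/\ uniq [:: i0; i1; i2; i3] && all (gtn m) [:: i0; i1; i2; i3],
        uniq [:: j0; j1; j2; j3] && all (gtn n) [:: j0; j1; j2; j3]
      & all (pred1 k) [:: M i0 j0; M i1 j0; M i1 j1; M i2 j1;
                          M i2 j2; M i3 j2; M i3 j3; M i0 j3]].

(** Serves for permuting rows and columns, for exchanging the colours ([b]), and for enlarging the
    board. *)
Lemma has_c8_reindex (m n m' n' : nat) (M : nat -> nat -> bool) (f g : nat -> nat)
    (b k : bool) :
  {in gtn m &, injective f} -> {in gtn m, forall i, f i < m'} ->
  {in gtn n &, injective g} -> {in gtn n, forall j, g j < n'} ->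
  has_c8 m n (fun i j => b (+) M (f i) (g j)) k -> has_c8 m' n' M (b (+) k).
Proof.
move=> inj_f lt_f inj_g lt_g [i0 [i1 [i2 [i3 [j0 [j1 [j2 [j3 [/andP[uI aI] /andP[uJ aJ] H]]]]]]]]].
exists (f i0), (f i1), (f i2), (f i3), (g j0), (g j1), (g j2), (g j3); split.
- rewrite -[[:: f _; _; _; _]]/(map f [:: i0; i1; i2; i3]).
  rewrite map_inj_in_uniq ?uI => [|x y /(allP aI) xm /(allP aI) ym]; last exact: inj_f.
  by rewrite [true && _]all_map; apply/allP=> x /(allP aI) /lt_f.
- rewrite -[[:: g _; _; _; _]]/(map g [:: j0; j1; j2; j3]).
  rewrite map_inj_in_uniq ?uJ => [|x y /(allP aJ) xm /(allP aJ) ym]; last exact: inj_g.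
  by rewrite [true && _]all_map; apply/allP=> x /(allP aJ) /lt_g.
- move: H; case: b => //=.
  by do 8!(case: (M _ _)); case: (k).
Qed.

(** The default [~~ k] keeps positions beyond the end of a row from counting as colour [k]. *)
Definition common (k : bool) (a b : bitseq) : seq nat :=
  [seq x <- iota 0 7 | (nth (~~ k) a x == k) && (nth (~~ k) b x == k)].

(** A cycle through four rows in a given cyclic order is a system of distinct representatives for
    the common columns of consecutive rows. *)
Definition c8_rows (k : bool) (a b c d : bitseq) : bool :=
  let ab := common k a b in let bc := common k b c in
  let cd := common k c d in let da := common k d a in
  has (fun p => has (fun q => (p != q) &&
    has (fun r => (p != r) && (q != r) &&
      has (fun s => [&& p != s, q != s & r != s]) da) cd) bc) ab.

Definition rowseq (M : nat -> nat -> bool) (i : nat) : bitseq := mkseq (M i) 7.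

Lemma mem_common (M : nat -> nat -> bool) k i i' j :
  (j \in common k (rowseq M i) (rowseq M i')) = [&& j < 7, M i j == k & M i' j == k].
Proof.
rewrite mem_filter mem_iota andbC /= add0n.
by case: ltnP => //= j7; rewrite !nth_mkseq.
Qed.

Lemma c8_rowsP (M : nat -> nat -> bool) (m : nat) (k : bool) :
  has_c8 m 7 M k <->
  exists i0 i1 i2 i3 : nat, uniq [:: i0; i1; i2; i3] && all (gtn m) [:: i0; i1; i2; i3] /\
    c8_rows k (rowseq M i0) (rowseq M i1) (rowseq M i2) (rowseq M i3).
Proof.
split.
  move=> [i0 [i1 [i2 [i3 [j0 [j1 [j2 [j3 [hI /andP[uJ aJ] H]]]]]]]]].
  exists i0, i1, i2, i3; split=> //.
  move: aJ H => /= /and5P[l0 l1 l2 l3 _] /and5P[e1 e2 e3 e4] /and5P[e5 e6 e7 e8 _].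
  move: uJ; rewrite /= !inE !negb_or => /and4P[/and3P[? ? ?] /andP[? ?] ? _].
  apply/hasP; exists j0; first by rewrite mem_common; apply/and3P.
  apply/hasP; exists j1; first by rewrite mem_common; apply/and3P.
  apply/andP; split=> //.
  apply/hasP; exists j2; first by rewrite mem_common; apply/and3P.
  apply/andP; split; first exact/andP.
  apply/hasP; exists j3; first by rewrite mem_common; apply/and3P.
  exact/and3P.
move=> [i0 [i1 [i2 [i3 [hI /hasP[j0]]]]]].
rewrite mem_common => /and3P[l0 e1 e2] /hasP[j1].
rewrite mem_common => /and3P[l1 e3 e4] /andP[n01] /hasP[j2].
rewrite mem_common => /and3P[l2 e5 e6] /andP[/andP[n02 n12]] /hasP[j3].
rewrite mem_common => /and3P[l3 e7 e8] /and3P[n03 n13 n23].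
exists i0, i1, i2, i3, j0, j1, j2, j3; split=> //.
  by rewrite /= !inE !negb_or n01 n02 n12 n03 n13 n23 l0 l1 l2 l3.
by rewrite /= e1 e2 e3 e4 e5 e6 e7 e8.
Qed.

(** * Lexicographic column order and the exhaustive search *)

(** Here [true] precedes [false]. *)
Fixpoint lex (x y : bitseq) : bool :=
  match x, y with
  | a :: x', b :: y' => if a == b then lex x' y' else a
  | _, _ => true
  end.

Lemma lex_total : total lex.
Proof. by elim=> [|[] x IH] [|[] y] //=. Qed.

(** Lets the search test column order after each row: sortedness of full columns passes to their
    prefixes. *)
Lemma lex_take (n : nat) (x y : bitseq) : lex x y -> lex (take n x) (take n y).
Proof. by elim: n x y => [|n IH] [|[] x] [|[] y] //=; exact: IH. Qed.

Definition columns (rows : seq bitseq) : seq bitseq :=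
  mkseq (fun j => [seq nth false r j | r <- rows]) 7.

Lemma columns_take (n : nat) (rows : seq bitseq) :
  columns (take n rows) = [seq take n c | c <- columns rows].
Proof. by rewrite /columns /mkseq -map_comp; apply: eq_map => j /=; rewrite map_take. Qed.

(* Only [i < l] is tried, as reversing a cycle through [v] exchanges [i] and [l]. *)
Definition clash (rows : seq bitseq) (v : bitseq) : bool :=
  let idx := iota 0 (size rows) in
  has (fun i => has (fun j => (i != j) && has (fun l => [&& i < l, j != l &
    let a := nth [::] rows i in let b := nth [::] rows j in let c := nth [::] rows l in
    c8_rows true a b c v || c8_rows false a b c v]) idx) idx) idx.

Fixpoint all_bitseqs (n : nat) : seq bitseq :=
  if n is n'.+1 then
    [seq true :: s | s <- all_bitseqs n'] ++ [seq false :: s | s <- all_bitseqs n']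
  else [:: [::]].

Lemma mem_all_bitseqs (s : bitseq) : s \in all_bitseqs (size s).
Proof.
elim: s => [|[] s IH] //=; rewrite mem_cat; apply/orP; [left|right]; exact: map_f.
Qed.

Definition admissible (rows : seq bitseq) (v : bitseq) : bool :=
  ((size rows < 4) ==> (3 < count id v)) && sorted lex (columns (rcons rows v)).

(** Success means that no [n] further rows complete [rows] to an admissible matrix without a clash;
    at depth 0 a survivor would be such a matrix, hence [false]. *)
Fixpoint refute (n : nat) (rows : seq bitseq) : bool :=
  if n is n'.+1 then
    all (fun v => [|| ~~ admissible rows v, clash rows v | refute n' (rcons rows v)])
      (all_bitseqs 7)
  else false.

Lemma refute_nil : refute 8 [::].
(* Lazy conversion is essential: the searches rely on [has] and [&&] stopping early. *)
Proof. exact_no_check (erefl true). Qed.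

Lemma refute_sound (M : nat -> nat -> bool) :
  (forall i, i < 4 -> 3 < count id (rowseq M i)) ->
  sorted lex (columns (mkseq (rowseq M) 8)) ->
  exists k, has_c8 8 7 M k.
Proof.
move=> major srt.
(* Follow the branch of the search given by the rows of [M] itself, with [k] rows placed and [n] to
   come. *)
have no_refute n k : n + k = 8 -> refute n (mkseq (rowseq M) k) -> exists c, has_c8 8 7 M c.
  elim: n k => // n IH k nk /allP/(_ (rowseq M k)).
  have -> : rowseq M k \in all_bitseqs 7.
    by rewrite -[X in all_bitseqs X](size_mkseq (M k) 7) mem_all_bitseqs.
  have rcons_row : rcons (mkseq (rowseq M) k) (rowseq M k) = mkseq (rowseq M) k.+1.
    by rewrite /mkseq -addn1 iotaD map_cat cats1.
  have lt_k8 : k < 8 by rewrite -nk addSn ltnS leq_addl.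
  move=> /(_ isT) /or3P[|/hasP[i]|].
  (* The rows of [M] are never rejected as inadmissible, so the branch can only end in a clash. *)
  - rewrite negb_and rcons_row size_mkseq negb_imply => /orP[/andP[/major->]//|/negP[]].
    have -> : mkseq (rowseq M) k.+1 = take k.+1 (mkseq (rowseq M) 8).
      by rewrite /mkseq -map_take take_iota (minn_idPl lt_k8).
    rewrite columns_take sorted_map; apply: sub_sorted srt => x y; exact: lex_take.
  - rewrite mem_iota size_mkseq /= add0n => ik /hasP[j]; rewrite mem_iota /= add0n => jk.
    move=> /andP[nij] /hasP[l]; rewrite mem_iota /= add0n => lk.
    case/and3P=> il njl; rewrite !nth_mkseq //.
    have wit : uniq [:: i; j; l; k] && all (gtn 8) [:: i; j; l; k].
      rewrite /= !inE !negb_or nij njl (ltn_eqF il) (ltn_eqF ik) (ltn_eqF jk) (ltn_eqF lk).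
      by rewrite (ltn_trans ik lt_k8) (ltn_trans jk lt_k8) (ltn_trans lk lt_k8) lt_k8.
    by case/orP=> C; [exists true|exists false]; apply/c8_rowsP; exists i, j, l, k.
  - by rewrite rcons_row; apply: IH; rewrite addnS.
exact: (no_refute 8 0 erefl refute_nil).
Qed.

(** * Normal form of an 8 by 7 matrix *)

(** Seven is odd, so each row has exactly one majority colour, and one of the two colours wins at
    least four of the eight rows. *)
Lemma majority_rows (M : nat -> nat -> bool) :
  exists b, 3 < count (fun i => 3 < count id (rowseq (fun i j => b (+) M i j) i)) (iota 0 8).
Proof.
pose p b i := 3 < count id (rowseq (fun i j => b (+) M i j) i).
have split_p i : p true i = ~~ p false i.
  rewrite /p -leqNgt /rowseq /mkseq !count_map.
  have -> : count (preim (fun j => true (+) M i j) id) (iota 0 7) =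
            count (predC (preim (fun j => false (+) M i j) id)) (iota 0 7) by [].
  set q := preim _ _.
  have := count_predC q (iota 0 7); rewrite size_iota => E.
  by rewrite -(ltn_add2l (count q (iota 0 7))) E addnC -[7]/(4 + 3) ltn_add2l ltnS.
have [le4|] := ltnP 3 (count (p false) (iota 0 8)); first by exists false.
move=> lt4; exists true; rewrite -/(p true) (eq_count split_p).
have := count_predC (p false) (iota 0 8); rewrite size_iota => E.
by rewrite -(leq_add2l (count (p false) (iota 0 8))) E -[8]/(4 + 4) leq_add2r ltnW.
Qed.

Lemma nth_perm_iota (n : nat) (s : seq nat) : perm_eq s (iota 0 n) ->
  {in gtn n &, injective (nth 0 s)} /\ {in gtn n, forall i, nth 0 s i < n}.
Proof.
move=> ps; have sz : size s = n by rewrite (perm_size ps) size_iota.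
split=> [x y xn yn /eqP|x xn].
  by rewrite nth_uniq ?sz ?(perm_uniq ps) ?iota_uniq // => /eqP.
have : nth 0 s x \in s by rewrite mem_nth ?sz.
by rewrite (perm_mem ps) mem_iota.
Qed.

Lemma has_c8_8x7 (M : nat -> nat -> bool) : exists k, has_c8 8 7 M k.
Proof.
have [b hb] := majority_rows M.
set p := (fun i => _) in hb.
(* Row order: those with the majority colour first. *)
pose s := filter p (iota 0 8) ++ filter (predC p) (iota 0 8).
have [injs lts] : {in gtn 8 &, injective (nth 0 s)} /\ {in gtn 8, forall i, nth 0 s i < 8}.
  by apply: nth_perm_iota; rewrite perm_filterC.
pose M1 i j := b (+) M (nth 0 s i) j.
pose cols := columns (mkseq (rowseq M1) 8).
have : perm_eq (sort lex cols) cols by rewrite perm_sort.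
(* [t] is the permutation of column indices that realises the sorting. *)
case/(perm_iotaP [::]) => t; rewrite size_mkseq => pt Et.
have [injt ltt] := nth_perm_iota pt.
have szt : size t = 7 by rewrite (perm_size pt) size_iota.
pose M2 i j := b (+) M (nth 0 s i) (nth 0 t j).
have [k Hk] : exists k, has_c8 8 7 M2 k.
  apply: refute_sound.
    move=> i i4.
    (* Permuting columns preserves the number of [true] entries in a row. *)
    have -> : count id (rowseq M2 i) = count id (rowseq M1 i).
      have -> : rowseq M2 i = map (M1 i) t.
        by rewrite -[in RHS](mkseq_nth 0 t) szt /rowseq /mkseq -map_comp.
      by apply/permP; rewrite /rowseq /mkseq perm_map.
    suff : p (nth 0 s i) by [].
    rewrite nth_cat size_filter (leq_trans i4 hb).
    have : nth 0 (filter p (iota 0 8)) i \in filter p (iota 0 8).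
      by rewrite mem_nth // size_filter (leq_trans i4 hb).
    by rewrite mem_filter => /andP[].
  have -> : columns (mkseq (rowseq M2) 8) = sort lex cols.
    rewrite Et -[in RHS](mkseq_nth 0 t) szt /columns /mkseq -map_comp.
    apply/eq_in_map => j; rewrite mem_iota /= add0n => j7.
    by rewrite /cols /columns /= !nth_mkseq ?ltt.
  exact: sort_sorted lex_total _.
by exists (b (+) k); apply: has_c8_reindex Hk.
Qed.

(** * The colouring of K_{7,7} *)

(** The red blocks have rows 0-2 with columns 0-3 and rows 3-5 with columns 0, 4, 5, 6. They share
    column 0; row 6 is entirely blue and is shared by the blue blocks. *)
Definition extremal (i j : nat) : bool := (i < 6) && ((j == 0) || ((i < 3) == (j < 4))).

(** Checked by evaluation over both colours and all quadruples of rows. *)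
Lemma extremal_free (k : bool) : ~ has_c8 7 7 extremal k.
Proof.
move/c8_rowsP => [i0 [i1 [i2 [i3 [/andP[uI /and5P[l0 l1 l2 l3 _]]]]]]].
apply/negP; move: uI; apply/implyP.
have chk : all (fun k => all (fun i0 => all (fun i1 => all (fun i2 => all (fun i3 =>
    uniq [:: i0; i1; i2; i3] ==> ~~ c8_rows k (rowseq extremal i0) (rowseq extremal i1)
      (rowseq extremal i2) (rowseq extremal i3))
    (iota 0 7)) (iota 0 7)) (iota 0 7)) (iota 0 7)) [:: true; false].
  exact_no_check (erefl true).
move/allP: chk => /(_ k); rewrite !inE; case: (k) => /(_ isT) /allP/(_ i0);
  rewrite mem_iota => /(_ l0) /allP/(_ i1); rewrite mem_iota => /(_ l1) /allP/(_ i2);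
  rewrite mem_iota => /(_ l2) /allP/(_ i3); rewrite mem_iota; exact.
Qed.

(** * Passing between cycles in graphs and in matrices *)

Lemma mono_c8_of_has_c8 (b : nat) (c : edge_coloring (biclique b.+1 b.+1)) (k : bool) :
  has_c8 b.+1 b.+1 (fun i j => c [set inl (inord i); inr (inord j)]) k ->
  mono_copy (cycle_graph 8) c k.
Proof.
move=> [i0 [i1 [i2 [i3 [j0 [j1 [j2 [j3 [/andP[uI aI] /andP[uJ aJ] H]]]]]]]]].
apply/mono_copyP.
pose L x : biclique b.+1 b.+1 := inl (inord x).
pose R x : biclique b.+1 b.+1 := inr (inord x).
pose w := [:: L i0; R j0; L i1; R j1; L i2; R j2; L i3; R j3].
have uw : uniq w.
  have inord_inj (l : seq nat) : all (gtn b.+1) l -> {in l &, injective (@inord b)}.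
    by move=> al x y /(allP al) xb /(allP al) yb /(congr1 val); rewrite /= !inordK.
  (* Rows and columns lie on different sides, so distinctness is checked on each side separately;
     [w] is a rearrangement of the two lists. *)
  have : uniq (map L [:: i0; i1; i2; i3] ++ map R [:: j0; j1; j2; j3]).
    rewrite cat_uniq !map_inj_in_uniq ?uI ?uJ //=.
    - by move=> x y xl yl [] /(inord_inj _ aJ x y xl yl).
    - by move=> x y xl yl [] /(inord_inj _ aI x y xl yl).
  rewrite -(@perm_uniq _ w) //; apply/permP => a; rewrite /= !addn0.
  by rewrite !(addnCA (a (R _)) (a (L _))).
exists (fun u : 'I_8 => nth (L 0) w u); split.
  by move=> u v /eqP; rewrite nth_uniq // => /eqP/val_inj.
move: H => /= /and5P[/eqP e1 /eqP e2 /eqP e3 /eqP e4].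
move=> /and5P[/eqP e5 /eqP e6 /eqP e7 /eqP e8 _].
have step (u : 'I_8) : biclique_adj (nth (L 0) w u) (nth (L 0) w (ordS u)) /\
    c [set nth (L 0) w u; nth (L 0) w (ordS u)] = k.
  by case: u => [[|[|[|[|[|[|[|[|u]]]]]]]] ltu] //=; split; rewrite // setUC.
move=> u v /andP[_ /orP[]/eqP<-]; first exact: step.
by rewrite setUC; have [s1 s2] := step v; split=> //; rewrite /= biclique_adj_sym.
Qed.

(** The image of the cycle alternates between the two sides, so even and odd positions supply the
    rows and columns, in one order or the other. *)
Lemma has_c8_of_mono_c8 (b : nat) (M : nat -> nat -> bool) (k : bool)
    (c : edge_coloring (biclique b b)) :
  (forall i j : 'I_b, c [set inl i; inr j] = M i j) ->
  mono_copy (cycle_graph 8) c k -> has_c8 b b M k.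
Proof.
move=> cM /mono_copyP[f [inj_f hf]].
have cM' (i j : 'I_b) : c [set inr j; inl i] = M i j by rewrite setUC.
have eql (x y : 'I_b) : (inl x == inl y :> biclique b b) = (val x == val y) by [].
have eqr (x y : 'I_b) : (inr x == inr y :> biclique b b) = (val x == val y) by [].
pose o x : 'I_8 := inord x.
have oE x : x < 8 -> val (o x) = x by exact: inordK.
have step x : x < 8 -> biclique_adj (f (o x)) (f (o (if x == 7 then 0 else x.+1))) /\
    c [set f (o x); f (o (if x == 7 then 0 else x.+1))] = k.
  move=> x8; apply: hf; rewrite /= /cycle_adj -!val_eqE /=.
  by case: x x8 => [|[|[|[|[|[|[|[|x]]]]]]]] //= _; rewrite !oE.
have neq x y : x < 8 -> y < 8 -> x != y -> f (o x) != f (o y).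
  by move=> x8 y8; apply: contra => /eqP/inj_f/(congr1 val); rewrite !oE // => ->.
move: (neq 0 2 isT isT isT) (neq 0 4 isT isT isT) (neq 0 6 isT isT isT)
  (neq 2 4 isT isT isT) (neq 2 6 isT isT isT) (neq 4 6 isT isT isT)
  (neq 1 3 isT isT isT) (neq 1 5 isT isT isT) (neq 1 7 isT isT isT)
  (neq 3 5 isT isT isT) (neq 3 7 isT isT isT) (neq 5 7 isT isT isT).
have [] := (step 0 isT, step 1 isT, step 2 isT, step 3 isT, step 4 isT, step 5 isT,
  step 6 isT, step 7 isT).
move=> /= [[[[[[[a0 c0] [a1 c1]] [a2 c2]] [a3 c3]] [a4 c4]] [a5 c5]] [a6 c6]] [a7 c7].
move: a0 a1 a2 a3 a4 a5 a6 a7 c0 c1 c2 c3 c4 c5 c6 c7.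
(* The eight adjacencies rule out all but the two alternating patterns. *)
case: (f (o 0)) => x0; case: (f (o 1)) => x1 //; case: (f (o 2)) => x2 //;
  case: (f (o 3)) => x3 //; case: (f (o 4)) => x4 //; case: (f (o 5)) => x5 //;
  case: (f (o 6)) => x6 //; case: (f (o 7)) => x7 // _ _ _ _ _ _ _ _;
  rewrite !cM !cM' !eql !eqr => e0 e1 e2 e3 e4 e5 e6 e7 n02 n04 n06 n24 n26 n46 n13 n15 n17 n35 n37 n57.
- exists x0, x2, x4, x6, x1, x3, x5, x7; split.
  + by rewrite /= !inE !negb_or n02 n04 n06 n24 n26 n46 !ltn_ord.
  + by rewrite /= !inE !negb_or n13 n15 n17 n35 n37 n57 !ltn_ord.
  + by rewrite /= e0 e1 e2 e3 e4 e5 e6 e7 eqxx.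
(* The cycle starts at a column here; rotating it by one position makes it start at the row [x1],
   with [x0] as last column. *)
- exists x1, x3, x5, x7, x2, x4, x6, x0; split.
  + by rewrite /= !inE !negb_or n13 n15 n17 n35 n37 n57 !ltn_ord.
  + rewrite /= !inE !negb_or n24 n26 n46 !ltn_ord.
    by rewrite (eq_sym (val x2)) (eq_sym (val x4)) (eq_sym (val x6)) n02 n04 n06.
  + by rewrite /= e0 e1 e2 e3 e4 e5 e6 e7 eqxx.
Qed.

(** * The two bounds *)

Lemma edge_biclique_inj (a b : nat) (i i' : 'I_a) (j j' : 'I_b) :
  [set inl i; inr j] = [set inl i'; inr j'] :> {set 'I_a + 'I_b} -> i = i' /\ j = j'.
Proof. by move/set2_eq => /(_ isT)[[[->] [->]]|[]]. Qed.

Lemma bip_arrows_c8_lower (b : nat) :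
  bip_arrows b (cycle_graph 8) (cycle_graph 8) -> 7 < b.
Proof.
move=> arr; rewrite ltnNge; apply/negP=> b7.
(* For [b] at most 7, colour by the upper left corner of [extremal]; a cycle there would also be one
   in the full 7 by 7 matrix. *)
pose c (e : {set biclique b b}) :=
  [exists i : 'I_b, exists j : 'I_b, (e == [set inl i; inr j]) && extremal i j].
have cM (i j : 'I_b) : c [set inl i; inr j] = extremal i j.
  apply/existsP/idP => [[i' /existsP[j' /andP[/eqP/edge_biclique_inj[-> ->]]]]|eij] //.
  by exists i; apply/existsP; exists j; rewrite eqxx.
by case: (arr c) => /(has_c8_of_mono_c8 cM) H;
  apply: (@extremal_free _ (has_c8_reindex (b := false) _ _ _ _ H));
  rewrite // => i ib; apply: leq_trans b7.
Qed.

Lemma bip_arrows_c8_8 : bip_arrows 8 (cycle_graph 8) (cycle_graph 8).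
Proof.
move=> c.
have [k Hk] := has_c8_8x7 (fun i j => c [set inl (inord i); inr (inord j)]).
(* The cycle found in the first seven columns is viewed in the 8 by 8 board. *)
have /mono_c8_of_has_c8 : has_c8 8 8 (fun i j => c [set inl (inord i); inr (inord j)]) k.
  apply: (has_c8_reindex (b := false) (f := id) (g := id) _ _ _ _ Hk) => //.
  by move=> j; apply: leqW.
by case: k {Hk}; [left|right].
Qed.

Theorem theorem5 : is_BR (cycle_graph 8) (cycle_graph 8) 8.
Proof.
by split=> // [|b _]; [exact: bip_arrows_c8_8|exact: bip_arrows_c8_lower].
Qed.
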